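(* Let $s<t$ be non-negative integers. For every integer $n\ge 1$, the Toeplitz graphs $G_n(z^s,z)$ and $G_n(z^s+z^t,z)$ are word-representable.
   Context: For a power series $g\in\mathbb{Z}[[z]]$, the Toeplitz graph (Riordan graph of Appell type) $G_n(g,z)$ is the simple graph on vertex set $[n]=\{1,\dots,n\}$ in which distinct vertices $x,y$ are adjacent if and only if the coefficient of $z^{|x-y|-1}$ in $g$ is odd. Thus in $G_n(z^s,z)$, $x\sim y$ iff $|x-y|=s+1$, and in $G_n(z^s+z^t,z)$, $x\sim y$ iff $|x-y|\in\{s+1,t+1\}$. Two distinct letters $x,y$ alternate in a word $w$ if deleting all other letters from $w$ yields a word of the form $xyxy\cdots$ or $yxyx\cdots$ (of even or odd length). A graph $G=(V,E)$ is word-representable if there is a word $w$ over the alphabet $V$ such that for all distinct $x,y\in V$, $x$ and $y$ alternate in $w$ if and only if $xy\in E$. *)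

(* Defs.v *)
From mathcomp Require Import all_boot all_order all_algebra.
Set Implicit Arguments.
Unset Strict Implicit.
Unset Printing Implicit Defensive.

Import GRing.Theory.

Record sgraph := SGraph {
  vertex :> finType;
  adj : rel vertex;
  adj_sym : symmetric adj;
  adj_irr : irreflexive adj }.

(* Elements of Z[[z]] are given by their coefficient sequences. *)
Definition pseries := nat -> int.

Definition pseries_of_poly (p : {poly int}) : pseries := fun k => (p`_k)%R.

(* [n] is rendered as 'I_n, i : 'I_n standing for i + 1; adjacency only
   depends on |x - y|. The predecessor is taken only when |x - y| > 0. *)
Definition toeplitz_adj (n : nat) (g : pseries) : rel 'I_n :=
  fun x y => (x != y) && odd `|g `|x - y|%N.-1|%N.

Lemma toeplitz_adj_sym n g : symmetric (@toeplitz_adj n g).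
Proof. by move=> x y; rewrite /toeplitz_adj eq_sym distnC. Qed.

Lemma toeplitz_adj_irr n g : irreflexive (@toeplitz_adj n g).
Proof. by move=> x; rewrite /toeplitz_adj eqxx. Qed.

Definition toeplitz_graph (n : nat) (g : pseries) : sgraph :=
  SGraph (@toeplitz_adj_sym n g) (@toeplitz_adj_irr n g).

(* The word x y x y ... of length k. *)
Definition alt_word (T : Type) (x y : T) (k : nat) : seq T :=
  mkseq (fun i => if odd i then y else x) k.

Definition alternate (T : eqType) (w : seq T) (x y : T) : Prop :=
  let r := [seq z <- w | (z == x) || (z == y)] in
  exists k : nat, r = alt_word x y k \/ r = alt_word y x k.

Definition word_representable (G : sgraph) : Prop :=
  exists w : seq G, forall x y : G, x != y -> (alternate w x y <-> adj x y).

(* Main.v *)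
Require Import Defs.
From mathcomp Require Import all_boot all_order all_algebra.
From mathcomp Require Import zify.

Set Implicit Arguments.
Unset Strict Implicit.
Unset Printing Implicit Defensive.

(** Each vertex has at most two smaller neighbours, so colouring the vertices
    greedily in increasing order uses three colours; and every 3-colourable
    graph is word-representable.  For the latter, orient the edges by
    increasing colour and concatenate uniform words, each of which restricts to
    x y x y ... x y on every edge x -> y.  A non-adjacent pair (u, v) is
    separated by a permutation listing the vertices by colour, perturbed so
    that v precedes u.  This fails only if u has the first and v the last
    colour; then p v u q, with p v and u q permutations listing the vertices by
    colour, may be replaced by p u v q, since no edge sees the exchange. *)

Section AlternatingWords.

Variable T : eqType.
Implicit Types (x y : T) (w : seq T).

Lemma alt_wordD x y a b :
  ~~ odd a -> alt_word x y (a + b) = alt_word x y a ++ alt_word x y b.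
Proof.
move=> aE; rewrite /alt_word /mkseq iotaD map_cat addnC iotaDl -map_comp.
congr (_ ++ _); apply: eq_map => i /=.
by rewrite oddD (negPf aE).
Qed.

(** A prefix of even length does not shift the phase, so the infix starts with [x] again. This lets
    a single bad piece spoil a whole concatenation. *)
Lemma alt_word_infix x y k p w q : ~~ odd (size p) ->
  p ++ w ++ q = alt_word x y k -> w = alt_word x y (size w).
Proof.
move=> pE E; have kE : k = size p + (size w + size q).
  by rewrite -(size_mkseq (fun i => if odd i then y else x) k)
             -/(alt_word x y k) -E !size_cat.
move: E; rewrite {}kE alt_wordD // => /eqP.
rewrite eqseq_cat ?size_mkseq // => /andP[_ /eqP E].
apply: (@eq_from_nth _ x) => [|i ltiw]; first by rewrite size_mkseq.
have := congr1 (fun l => nth x l i) E; rewrite nth_cat ltiw => ->.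
by rewrite !nth_mkseq // ltn_addr.
Qed.

Definition restr w x y : seq T := [seq z <- w | (z == x) || (z == y)].

Lemma restrC w x y : restr w x y = restr w y x.
Proof. by apply: eq_filter => z; rewrite orbC. Qed.

Lemma restr_cat w1 w2 x y : restr (w1 ++ w2) x y = restr w1 x y ++ restr w2 x y.
Proof. exact: filter_cat. Qed.

Lemma size_restr w x y :
  x != y -> size (restr w x y) = count_mem x w + count_mem y w.
Proof.
move=> nxy; rewrite size_filter -[RHS]count_predUI -[LHS]addn0; congr (_ + _).
rewrite (eq_count (a2 := pred0)) ?count_pred0 // => z /=.
by case: eqP => // ->; rewrite (negPf nxy).
Qed.

(** Equal letter counts force restrictions to two letters to have even length, so a piece does not
    disturb the phase of the pieces after it. *)
Definition uniform w : Prop := exists k, forall x, count_mem x w = k.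

Lemma even_size_restr w x y :
  uniform w -> x != y -> ~~ odd (size (restr w x y)).
Proof.
by move=> [k wk] nxy; rewrite size_restr // !wk addnn odd_double.
Qed.

Lemma uniform_flatten (ws : seq (seq T)) :
  {in ws, forall w, uniform w} -> uniform (flatten ws).
Proof.
elim: ws => [|w ws IH] wsU; first by exists 0.
have [k wk] := wsU w (mem_head _ _).
have [|l wsl] := IH; first by move=> v vws; apply: wsU; rewrite in_cons vws orbT.
by exists (k + l) => x; rewrite /= count_cat wk wsl.
Qed.

(** Fixing both the first letter and the parity of the length makes this property stable under
    concatenation. *)
Definition respects (e : rel T) w : Prop :=
  forall x y, e x y -> exists k, restr w x y = alt_word x y k.*2.

Lemma respects_flatten (e : rel T) (ws : seq (seq T)) :
  {in ws, forall w, respects e w} -> respects e (flatten ws).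
Proof.
move=> wsR x y exy; elim: ws wsR => [|w ws IH] wsR; first by exists 0.
have [k wk] := wsR w (mem_head _ _) x y exy.
have [|l wsl] := IH; first by move=> v vws; apply: wsR; rewrite in_cons vws orbT.
exists (k + l); rewrite /= restr_cat wk wsl doubleD alt_wordD //.
by rewrite odd_double.
Qed.

End AlternatingWords.

(** One piece is taken for each ordered pair. The piece for [(u, v)] only has to exclude alternation
    starting with [u]; the piece for [(v, u)] excludes the other start. *)
Lemma representable_by_pieces (G : sgraph) (e : rel G) :
    (forall x y, adj x y = e x y || e y x) ->
    (forall u v : G, u != v -> ~~ adj u v -> exists w : seq G,
      [/\ uniform w, respects e w & forall k, restr w u v <> alt_word u v k]) ->
  word_representable G.
Proof.
move=> adjE sep.
(* Equal or adjacent pairs get the empty word, so that [W] is defined on all pairs. *)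
have /fin_all_exists[W WP] : forall p : G * G, exists w : seq G,
    [/\ uniform w, respects e w & p.1 != p.2 -> ~~ adj p.1 p.2 ->
        forall k, restr w p.1 p.2 <> alt_word p.1 p.2 k].
  move=> [u v] /=; have [->|nuv] := eqVneq u v.
    exists [::]; split=> //; first by exists 0.
    by move=> x y _; exists 0.
  have [auv|nauv] := boolP (adj u v); last first.
    by have [w [wU wR wS]] := sep u v nuv nauv; exists w.
  exists [::]; split=> //; first by exists 0.
  by move=> x y _; exists 0.
pose w := flatten [seq W p | p <- enum {: G * G}].
have wR : respects e w.
  by apply: respects_flatten => _ /mapP[p _ ->]; have [] := WP p.
have noalt u v k : u != v -> ~~ adj u v -> restr w u v <> alt_word u v k.
  move=> nuv nauv; rewrite /w.
  have /splitPr[s1 s2] : (u, v) \in enum {: G * G} by rewrite mem_enum.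
  rewrite map_cat flatten_cat /= !restr_cat => /alt_word_infix E.
  have [_ _ /(_ nuv nauv)] := WP (u, v); apply; apply: E.
  apply: even_size_restr => //; apply: uniform_flatten => _ /mapP[p _ ->].
  by have [] := WP p.
exists w => x y nxy; rewrite /alternate /= -/(restr w x y); split.
  move=> [k H]; apply/negPn/negP => nadj; case: H => H.
    exact: noalt nxy nadj H.
  by rewrite restrC in H; apply: noalt H; rewrite 1?eq_sym // adj_sym.
rewrite adjE => /orP[] /wR[k E]; exists k.*2; first by left.
by right; rewrite restrC.
Qed.

Section RankPermutation.

Variables (T : finType) (r : T -> nat).

Definition rank_perm : seq T := sort (relpre r leq) (enum T).

Lemma rank_perm_uniq : uniq rank_perm.
Proof. by rewrite sort_uniq enum_uniq. Qed.

Lemma mem_rank_perm x : x \in rank_perm.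
Proof. by rewrite mem_sort mem_enum. Qed.

Lemma count_rank_perm x : count_mem x rank_perm = 1.
Proof. by rewrite count_uniq_mem ?rank_perm_uniq // mem_rank_perm. Qed.

Lemma restr_rank_perm x y : r x < r y -> restr rank_perm x y = [:: x; y].
Proof.
move=> ltr; have nxy : x != y by apply: contraTneq ltr => ->; rewrite ltnn.
have sS : sorted (relpre r leq) (restr rank_perm x y).
  apply: sorted_filter; first by move=> a b c; apply: leq_trans.
  by apply: sort_sorted => a b; apply: leq_total.
have sP : perm_eq (restr rank_perm x y) [:: x; y].
  apply: uniq_perm; rewrite ?filter_uniq ?rank_perm_uniq //=.
    by rewrite inE nxy.
  by move=> z; rewrite mem_filter mem_rank_perm andbT !inE.
move: (restr _ _ _) sS sP => [|a [|b [|c l]]] sS sP;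
  try by have := perm_size sP.
have := perm_mem sP a; have := perm_mem sP b; have := perm_uniq sP.
rewrite /= !inE !eqxx !orbT nxy /= andbT.
move=> nab /esym/orP[/eqP bE|/eqP bE] /esym/orP[/eqP aE|/eqP aE].
(* Distinctness leaves the orders [x y] and [y x]; sortedness excludes the second. *)
all: move: nab sS; rewrite aE bE ?eqxx //= andbT => _.
by rewrite leqNgt ltr.
Qed.

Lemma rank_perm_respects (e : rel T) :
  (forall x y, e x y -> r x < r y) -> respects e rank_perm.
Proof. by move=> er x y /er/restr_rank_perm->; exists 1. Qed.

End RankPermutation.

Theorem three_colorable_word_representable (G : sgraph) (c : G -> 'I_3) :
  (forall x y, adj x y -> c x != c y) -> word_representable G.
Proof.
move=> cP; pose e : rel G := fun x y => adj x y && (c x < c y).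
apply: (@representable_by_pieces G e) => [x y|u v nuv nauv].
  rewrite /e (adj_sym y x) -andb_orr; case: (boolP (adj x y)) => //= /cP.
  by rewrite -(inj_eq val_inj) neq_ltn => ->.
have neuv : forall x y, e x y -> ~~ ((x == u) && (y == v)).
  move=> x y /andP[axy _]; apply/negP => /andP[/eqP xu /eqP yv].
  by rewrite -xu -yv axy in nauv.
have [cvu|cuv] := leqP (c v) (c u).+1.
  (* Relative to the other vertices u moves up and v down by 2: less than the
     gap 3 between colours, but their sum exceeds it. *)
  pose r x := 3 * c x + 2 * (x == u) + 2 * (x != v).
  have ltr x y : e x y -> r x < r y.
    move=> exy; have := neuv _ _ exy; case/andP: exy => _; rewrite /r.
    by case: (x == u); case: (y == v); case: (y == u); case: (x == v) => //=; lia.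
  exists (rank_perm r); split.
  - by exists 1 => x; rewrite count_rank_perm.
  - exact: rank_perm_respects.
  move=> k; rewrite restrC restr_rank_perm; last first.
    by rewrite /r !eqxx eq_sym (negPf nuv) /=; lia.
  move=> E; have := congr1 size E; rewrite size_mkseq => kE.
  by move: E; rewrite -kE => -[/esym/eqP]; rewrite (negPf nuv).
have [cu cv] : c u = 0 :> nat /\ c v = 2 :> nat by have := ltn_ord (c v); lia.
pose b := rank_perm (fun x => c x : nat).
(* On the pair this reads [u u v v], which does not alternate. *)
pose w := [seq z <- b | z != v] ++ [:: u; v] ++ [seq z <- b | z != u].
have restr_w x y : restr w x y =
    [seq z <- restr b x y | z != v] ++ restr [:: u; v] x y
    ++ [seq z <- restr b x y | z != u].
  rewrite !restr_cat /restr -!filter_predI; congr (_ ++ _ ++ _);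
  by apply: eq_filter => z /=; rewrite andbC.
have buv : restr b u v = [:: u; v] by apply: restr_rank_perm; lia.
exists w; split.
- exists 2 => x; rewrite !count_cat /=.
  have countD z : count_mem x [seq t <- b | t != z] = (x != z).
    rewrite count_filter; case: eqVneq => [->|nxz].
      rewrite (eq_count (a2 := pred0)) ?count_pred0 // => t /=.
      by case: eqP.
    rewrite -[RHS](count_rank_perm (fun x => c x : nat) x).
    by apply: eq_count => t /=; case: eqP => // ->.
  by rewrite !countD (eq_sym u) (eq_sym v); case: (x == u); case: (x == v).
- move=> x y exy; have := neuv _ _ exy; case/andP: exy => _ cxy nxyuv.
  exists 2; rewrite restr_w restr_rank_perm //= ![u == _]eq_sym ![v == _]eq_sym.
  (* No edge leaves the last colour or enters the first. So an edge meets [u] only as its tail and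
     [v] only as its head, and never both; in each case the restriction is [x y x y]. *)
  have nxv : x != v by apply: contraTneq cxy => ->; have := ltn_ord (c y); lia.
  have nyu : y != u by apply: contraTneq cxy => ->; lia.
  rewrite (negPf nxv) (negPf nyu) /= !orbF /alt_word /mkseq /=.
  case: (eqVneq x u) nxyuv => [xu|_]; case: (eqVneq y v) => [yv|_] //=.
  + by rewrite xu.
  + by rewrite yv.
move=> k; rewrite restr_w buv /= !eqxx (eq_sym v u) nuv /= orbT => E.
have := congr1 size E; rewrite size_mkseq /= => kE.
by move: E; rewrite -kE => -[/eqP]; rewrite (negPf nuv).
Qed.

Lemma two_distances_three_colorable (a b n : nat) : 0 < a -> 0 < b ->
  exists c : nat -> 'I_3, forall i j, i < j < n ->
    (j == i + a) || (j == i + b) -> c i != c j.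
Proof.
move=> a0 b0; elim: n => [|n [c cP]].
  by exists (fun=> ord0) => i j; rewrite ltn0 andbF.
(* If [n < a] or [n < b], the truncated difference is 0 and forbids a colour needlessly; still at
   most two of the three colours are forbidden. *)
have /existsP[m /andP[ma mb]] :
    [exists m : 'I_3, (c (n - a) != m) && (c (n - b) != m)].
  apply/existsP; move: (c (n - a)) (c (n - b)) => p q.
  have /set0Pn[m] : ~: [set p; q] != set0.
    by rewrite -card_gt0 cardsCs setCK cards2 card_ord; case: (p != q).
  by rewrite !inE negb_or => /andP[mp mq]; exists m; rewrite ![_ == m]eq_sym mp.
exists (fun i => if i == n then m else c i) => i j /andP[ltij].
rewrite ltnS leq_eqVlt => /predU1P[-> | ltjn] ijab.
  rewrite eqxx ifN; last by case/orP: ijab => /eqP ->; lia.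
  by case/orP: ijab => /eqP nE; [move: ma | move: mb]; rewrite nE addnK.
by rewrite !ifN ?cP ?ltij //; lia.
Qed.

(** The exponents may coincide, so the monomial [z^s] is covered by taking [t = s]. *)
Lemma toeplitz_two_distances_word_representable (n s t : nat) (g : pseries) :
    (forall k, odd `|g k|%N -> (k == s) || (k == t)) ->
  word_representable (toeplitz_graph n g).
Proof.
move=> gP.
(* The coefficient of [z^k] governs the distance [k + 1], hence the successors. *)
have [c cP] := @two_distances_three_colorable s.+1 t.+1 n isT isT.
apply: (@three_colorable_word_representable (toeplitz_graph n g)
  (fun x => c (x : 'I_n))).
move=> /= x y; wlog ltxy : x y / x < y => [IH|].
  move=> axy; case: (ltngtP x y) => [/IH|/IH|/val_inj E].
  - exact.
  - by rewrite eq_sym; apply; rewrite toeplitz_adj_sym.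
  - by move: axy; rewrite E toeplitz_adj_irr.
move=> /andP[_ /gP]; rewrite distnEr ?(ltnW ltxy) // => xyst.
by apply: cP; rewrite ?ltxy ?ltn_ord //; lia.
Qed.

Theorem theorem1 (s t : nat) (hst : s < t) (n : nat) (hn : 1 <= n) :
  word_representable (toeplitz_graph n (pseries_of_poly 'X^s%R)) /\
  word_representable (toeplitz_graph n (pseries_of_poly ('X^s + 'X^t)%R)).
Proof.
split.
  apply: (@toeplitz_two_distances_word_representable n s s) => k.
  by rewrite /pseries_of_poly coefXn; case: (k == s).
apply: (@toeplitz_two_distances_word_representable n s t) => k.
rewrite /pseries_of_poly coefD !coefXn.
by case: (k == s); case: (k == t).
Qed.
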